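(* Let $U$ be an open neighborhood of the origin in $\mathbb{R}^n$, let $m\in\mathbb{N}_0$ and let $P\in\operatorname{DO}^m(U)$. Then, as $t\to0$, we have $$\delta_t^*P\simeq\sum_{\ell\ge-mr}t^\ell P^{[\ell]}\qquad\text{in }\operatorname{DO}^m(U),$$ where $P^{[\ell]}$ is a homogeneous differential operator of degree $\ell$.
   Context: $(w_1,\ldots,w_n)$ is the weight sequence of an $n$-dimensional Carnot manifold of step $r$; all that matters here is that it is a non-decreasing sequence of integers in $\{1,\ldots,r\}$. Set $\delta_t(x)=t\cdot x=(t^{w_1}x_1,\ldots,t^{w_n}x_n)$. $\operatorname{DO}^m(U)$ is the space of differential operators $P=\sum_{|\alpha|\le m}a_\alpha(x)\partial_x^\alpha$ on $U$ with coefficients $a_\alpha\in C^\infty(U)$, with the topology given by the $C^\infty(U)$-topology (uniform convergence of all derivatives on compact sets) on each coefficient. For $t\ne0$, $\delta_t^*P$ is the differential operator on $\delta_t^{-1}(U)$ given by $(\delta_t^*P)u(x)=P(u\circ\delta_t^{-1})(t\cdot x)$. A differential operator $Q$ on $\mathbb{R}^n$ is homogeneous of degree $\ell\in\mathbb{Z}$ if $\delta_t^*Q=t^\ell Q$ for all $t\in\mathbb{R}\setminus\{0\}$. The asymptotic expansion means that, for every integer $N$ and every compact $K\subset U$, all derivatives of all coefficients of $\delta_t^*P-\sum_{-mr\le\ell<N}t^\ell P^{[\ell]}$ are $\operatorname{O}(t^N)$ uniformly on $K$ as $t\to0$ (for $t$ small, $\delta_t^*P$ is defined near $K$). *)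

(* Defs.v *)
From HB Require Import structures.
From mathcomp Require Import all_boot all_order all_algebra.
From mathcomp Require Import all_classical all_reals all_analysis.

Set Implicit Arguments.
Unset Strict Implicit.
Unset Printing Implicit Defensive.
Import Order.TTheory GRing.Theory Num.Theory.
Import numFieldNormedType.Exports.
Local Open Scope classical_set_scope.
Local Open Scope ring_scope.

(** * Smooth functions on an open subset of R^n

    A function on [U] is represented by a total function; its values outside
    [U] are irrelevant. *)

Section Smooth.
Context {R : realType} {n : nat}.
Implicit Types (U : set 'rV[R]_n) (f : 'rV[R]_n -> R).

(* iterated_partial [:: i1; ...; ik] f = d_i1 (d_i2 (... (d_ik f))) *)
Definition iterated_partial (s : seq 'I_n) f : 'rV[R]_n -> R :=
  foldr (fun i (g : 'rV[R]_n -> R) => 'D_(delta_mx 0 i) g) f s.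

Definition smooth_on U f : Prop :=
  forall (s : seq 'I_n) (x : 'rV[R]_n), U x ->
    {for x, continuous (iterated_partial s f)} /\
    forall i : 'I_n, derivable (iterated_partial s f) x (delta_mx 0 i).

Definition partial_pow (a : 'I_n -> nat) f : 'rV[R]_n -> R :=
  iterated_partial (flatten [seq nseq (a i) i | i <- enum 'I_n]) f.

End Smooth.

(** * Differential operators *)

(* Multi-indices [a] with [|a| <= m]; the bound ['I_m.+1] on the entries loses
   nothing and makes the type finite. *)
Definition mindex (n m : nat) : finType :=
  {a : {ffun 'I_n -> 'I_m.+1} | (\sum_i a i <= m)%N}.

Definition mindex_fun n m (a : mindex n m) (i : 'I_n) : nat := val a i.

Record diffop (R : realType) (n m : nat) (U : set 'rV[R]_n) := DiffOp {
  coef : mindex n m -> 'rV[R]_n -> R;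
  coef_smooth : forall a : mindex n m, smooth_on U (coef a) }.

(* [diffop_act P u] is meaningful on [U] for [u] smooth on [U]. The formula is
   local, so an operator on R^n also acts on functions on an open subset. *)
Definition diffop_act (R : realType) (n m : nat) (U : set 'rV[R]_n)
    (P : diffop m U) (u : 'rV[R]_n -> R) (x : 'rV[R]_n) : R :=
  \sum_(a : mindex n m) coef P a x * partial_pow (mindex_fun a) u x.
Coercion diffop_act : diffop >-> Funclass.

(** * Dilations *)

Section Dilation.
Context {R : realType} {n : nat} (w : 'I_n -> nat).

Definition dilation (t : R) (x : 'rV[R]_n) : 'rV[R]_n :=
  \row_i (t ^+ w i * x 0 i).

(* For [t != 0], the inverse of [dilation t] is [dilation t^-1]. *)
Definition pullback (t : R) (T : ('rV[R]_n -> R) -> 'rV[R]_n -> R)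
    (u : 'rV[R]_n -> R) (x : 'rV[R]_n) : R :=
  T (u \o dilation t^-1) (dilation t x).

(* [D] is the differential operator [delta_t^* P] on [delta_t^{-1}(U)] (its
   coefficients on that set are uniquely determined by this). *)
Definition is_pullback (m : nat) (U : set 'rV[R]_n) (t : R) (P : diffop m U)
    (D : diffop m (dilation t @^-1` U)) : Prop :=
  forall u, smooth_on (dilation t @^-1` U) u ->
    forall x, (dilation t @^-1` U) x -> D u x = pullback t P u x.

Definition homogeneous (m : nat) (l : int)
    (Q : diffop m [set: 'rV[R]_n]) : Prop :=
  forall t : R, t != 0 -> forall u, smooth_on [set: 'rV[R]_n] u ->
    forall x, pullback t Q u x = t ^ l * Q u x.

End Dilation.

(* The integers [l] with [a <= l < b], in increasing order. *)
Definition zrange (a b : int) : seq int :=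
  [seq a + k%:Z | k <- iota 0 (absz (Num.max 0 (b - a)))].

(** * Asymptotic expansion as t -> 0

    [D t] is an operator defined near any given compact subset of [U] as soon
    as [t] is small; [0^'] is the filter of punctured neighborhoods of 0, so
    that [t] takes both signs. The constant [C] may depend on [N], [K] and on
    the coefficient and derivative considered, but not on [t] and [x]. *)
Definition asymptotic_expansion (R : realType) (n m : nat) (w : 'I_n -> nat)
    (U : set 'rV[R]_n) (D : forall t : R, diffop m (dilation w t @^-1` U))
    (l0 : int) (Q : int -> diffop m [set: 'rV[R]_n]) : Prop :=
  forall (N : int) (K : set 'rV[R]_n), compact K -> K `<=` U ->
  forall (a : mindex n m) (s : seq 'I_n),
  exists C : R, \forall t \near (0 : R)^', forall x : 'rV[R]_n, K x ->
    `| iterated_partial s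
         (fun y => coef (D t) a y
                   - \sum_(l <- zrange l0 N) t ^ l * coef (Q l) a y) x |
    <= C * `| t ^ N |.

(* Main.v *)
(* In coordinates, the coefficient of [d^a] in [delta_t^* P] is
   [t^(-<w,a>) c_a(delta_t x)], so [P^[l]] has for coefficient of [d^a] the part
   of weighted degree [l + <w,a>] of the Taylor series of [c_a] at 0, and the
   remainder is [t^(-<w,a>) g(delta_t x)], where all derivatives of [g] of
   weight less than [N + <w,a>] vanish at 0. That [g(delta_t x)] is then
   [O(t^(N + <w,a>))] follows by induction on the weight: on the box
   [|y_j| <= rho |t|^(w_j)], moving from 0 to [y] one coordinate at a time, the
   mean value theorem bounds [g(y)] by the sum of the
   [rho |t|^(w_i) sup |d_i g|], and the vanishing order of [d_i g] has dropped by
   [w_i] only. *)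
Require Import Defs.
From mathcomp Require Import all_boot all_order all_algebra.
From mathcomp Require Import all_classical all_reals all_analysis.
Import Order.TTheory GRing.Theory Num.Theory.
Import numFieldNormedType.Exports.
Local Open Scope classical_set_scope.
Local Open Scope ring_scope.

(** * Derivatives along lines *)

Section LineDerivatives.
Set Implicit Arguments.
Unset Strict Implicit.
Context {R : realType} {V : normedModType R}.
Implicit Types (f : V -> R) (x v : V).

(** Both sides have literally the same difference quotient, so existence and value transfer
    together. This reduces directional derivatives to one-variable calculus. *)
Lemma is_derive_line f x v (s df : R) :
  is_derive (s *: v + x) v f df -> is_derive s 1 (fun h : R => f (h *: v + x)) df.
Proof.
have gE : (fun h : R => h^-1 *: ((f \o shift (s *: v + x)) (h *: v) - f (s *: v + x))) =
  (fun h => h^-1 *: (((fun h : R => f (h *: v + x)) \o shift s) (h *: 1)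
                   - f (s *: v + x))).
  by rewrite funeqE => h /=; rewrite [_%:A]mulr1 scalerDl addrA.
by case=> dvf vE; split; [move: dvf|move: vE]; rewrite /derivable /derive gE.
Qed.

Lemma line_is_derive f x v (df : R) :
  is_derive (0 : R) 1 (fun h : R => f (h *: v + x)) df -> is_derive x v f df.
Proof.
have gE : (fun h : R => h^-1 *: ((f \o shift x) (h *: v) - f x)) =
  (fun h => h^-1 *: (((fun h : R => f (h *: v + x)) \o shift 0) (h *: 1)
                   - f (0 *: v + x))).
  by rewrite funeqE => h /=; rewrite [_%:A]mulr1 addr0 scale0r add0r.
by case=> dvf vE; split; [move: dvf|move: vE]; rewrite /derivable /derive gE.
Qed.

Lemma is_derive_translate f x u v (df : R) :
  is_derive (x + u) v f df -> is_derive x v (fun y => f (y + u)) df.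
Proof.
have gE : (fun h : R => h^-1 *: ((f \o shift (x + u)) (h *: v) - f (x + u))) =
  (fun h => h^-1 *: (((fun y => f (y + u)) \o shift x) (h *: v) - f (x + u))).
  by rewrite funeqE => h /=; rewrite addrA.
by case=> dvf vE; split; [move: dvf|move: vE]; rewrite /derivable /derive gE.
Qed.

(** The range [|s| <= |a|] is symmetric so that callers need not know the sign of [a]; the proof
    applies the mean value theorem on [[0, a]] or [[a, 0]]. *)
Lemma MVT_line f x v (a : R) :
  (forall s : R, `|s| <= `|a| -> derivable f (s *: v + x) v) ->
  exists2 s : R, `|s| <= `|a| & f (a *: v + x) - f x = a * 'D_v f (s *: v + x).
Proof.
move=> df; pose g (h : R) := f (h *: v + x).
have dg (s : R) : `|s| <= `|a| -> is_derive s 1 g ('D_v f (s *: v + x)).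
  by move=> sa; apply/is_derive_line/derivableP/df.
have cg (i : interval R) : (forall s, s \in i -> `|s| <= `|a|) ->
    {within [set` i], continuous g}.
  move=> ia; apply: derivable_within_continuous => s si.
  by apply: (@ex_derive _ _ _ _ _ _ _ (dg s _)); exact: ia.
have g0 : g 0 = f x by rewrite /g scale0r add0r.
have [a0|a0] := leP 0 a.
- have ia s : s \in `[0, a] -> `|s| <= `|a|.
    by rewrite in_itv/= => /andP[s0 sa]; rewrite !ger0_norm.
  have [||s sa] := @MVT_segment R g (fun s => 'D_v f (s *: v + x)) 0 a a0.
  - by move=> s sa; apply: dg; apply: ia; apply: subset_itv_oo_cc sa.
  - exact: cg.
  rewrite subr0 mulrC g0 => gE; exists s => //; exact: ia.
- have ia s : s \in `[a, 0] -> `|s| <= `|a|.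
    by rewrite in_itv/= => /andP[s0 sa]; rewrite !ler0_norm ?lerN2// ltW.
  have [||s sa] := @MVT_segment R g (fun s => 'D_v f (s *: v + x)) a 0 (ltW a0).
  - by move=> s sa; apply: dg; apply: ia; apply: subset_itv_oo_cc sa.
  - exact: cg.
  rewrite sub0r g0 => gE; exists s; first exact: ia.
  by rewrite -opprB gE mulrN opprK mulrC.
Qed.

End LineDerivatives.

(** * Calculus of iterated partial derivatives *)

Section IteratedPartials.
Set Implicit Arguments.
Unset Strict Implicit.
Context {R : realType} {n : nat}.
Implicit Types (U : set 'rV[R]_n) (f g : 'rV[R]_n -> R) (s : seq 'I_n).

Lemma iterated_partial_cat s1 s2 f :
  iterated_partial (s1 ++ s2) f = iterated_partial s1 (iterated_partial s2 f).
Proof. by rewrite /iterated_partial foldr_cat. Qed.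

Lemma smooth_on_iterated_partial U s f :
  smooth_on U f -> smooth_on U (iterated_partial s f).
Proof. by move=> sf s' x Ux; rewrite -iterated_partial_cat; exact: sf. Qed.

Lemma smooth_on_is_derive U f s i x : smooth_on U f -> U x ->
  is_derive x (delta_mx 0 i) (iterated_partial s f) (iterated_partial (i :: s) f x).
Proof. by move=> sf Ux; apply: derivableP; have [_] := sf s x Ux; exact. Qed.

Lemma open_near U x : open U -> U x -> \forall y \near x, U y.
Proof. by move=> oU Ux; apply: open_nbhs_nbhs; split. Qed.

(** Main tool for smoothness: one guesses all iterated derivatives [G s] at once. Induction on the
    word works because a derivative at [x] sees only values near [x], and these lie in the open set
    [U]. *)
Lemma smooth_on_family U f (G : seq 'I_n -> 'rV[R]_n -> R) : open U ->
  (forall x, U x -> f x = G [::] x) ->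
  (forall s x, U x -> {for x, continuous (G s)}) ->
  (forall s i x, U x -> is_derive x (delta_mx 0 i) (G s) (G (i :: s) x)) ->
  smooth_on U f /\ forall s x, U x -> iterated_partial s f x = G s x.
Proof.
move=> oU fG cG dG.
have nE s : (forall x, U x -> iterated_partial s f x = G s x) ->
    forall x, U x -> \forall y \near x, G s y = iterated_partial s f y.
  by move=> sE x Ux; apply: filterS (open_near oU Ux) => y Uy; rewrite sE.
have E s : forall x, U x -> iterated_partial s f x = G s x.
  elim: s => [|i s IH] x Ux; first exact: fG.
  by have [_] := near_eq_is_derive (nE s IH x Ux) (dG s i x Ux).
split => // s x Ux; split => [|i]; last first.
  by have [] := near_eq_is_derive (nE s (E s) x Ux) (dG s i x Ux).
rewrite /prop_for /continuous_at (E s x Ux).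

by apply: cvg_trans (cG s x Ux); exact: near_eq_cvg (nE s (E s) x Ux).
Qed.

(** Values outside [U] are arbitrary, so [f] and [g] may differ as functions; locality of
    derivatives replaces extensionality. *)
Lemma smooth_on_ext U f g : open U -> (forall x, U x -> f x = g x) ->
  smooth_on U g ->
  smooth_on U f /\ forall s x, U x -> iterated_partial s f x = iterated_partial s g x.
Proof.
move=> oU fg sg.
apply: (smooth_on_family (G := fun s => iterated_partial s g)) => // [s x Ux|s i x Ux].
  by have [] := sg s x Ux.
exact: smooth_on_is_derive sg Ux.
Qed.

Lemma smooth_onB U f g : open U -> smooth_on U f -> smooth_on U g ->
  smooth_on U (fun x => f x - g x) /\
  forall s x, U x -> iterated_partial s (fun x => f x - g x) x =
    iterated_partial s f x - iterated_partial s g x.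
Proof.
move=> oU sf sg; apply: (smooth_on_family (G := fun s x =>
  iterated_partial s f x - iterated_partial s g x)) => // [s x Ux|s i x Ux].
  exact: cvgB (proj1 (sf s x Ux)) (proj1 (sg s x Ux)).
exact: is_deriveB (smooth_on_is_derive s i sf Ux) (smooth_on_is_derive s i sg Ux).
Qed.

Lemma smooth_onZ U (k : R) f : open U -> smooth_on U f ->
  smooth_on U (fun x => k * f x) /\
  forall s x, U x -> iterated_partial s (fun x => k * f x) x =
    k * iterated_partial s f x.
Proof.
move=> oU sf; apply: (smooth_on_family (G := fun s x =>
  k * iterated_partial s f x)) => // [s x Ux|s i x Ux].
  exact: cvgM (@cvg_cst _ k _ (nbhs x) _) (proj1 (sf s x Ux)).
exact: is_deriveZ (smooth_on_is_derive s i sf Ux).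
Qed.

Lemma smooth_on_cst U (k : R) : open U ->
  smooth_on U (fun=> k) /\
  forall s x, U x -> iterated_partial s (fun=> k) x = if s is [::] then k else 0.
Proof.
move=> oU.
apply: (smooth_on_family (G := fun s _ => if s is [::] then k else 0)) => //.
  by move=> s x Ux; exact: cst_continuous.
Qed.

Lemma smooth_on_sum U (I : Type) (r : seq I) (P : pred I)
    (F : I -> 'rV[R]_n -> R) : open U -> (forall i, smooth_on U (F i)) ->
  smooth_on U (fun x => \sum_(i <- r | P i) F i x) /\
  forall s x, U x -> iterated_partial s (fun x => \sum_(i <- r | P i) F i x) x =
    \sum_(i <- r | P i) iterated_partial s (F i) x.
Proof.
move=> oU sF; apply: (smooth_on_family (G := fun s x =>
  \sum_(i <- r | P i) iterated_partial s (F i) x)) => // [s x Ux|s i x Ux].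
  rewrite /prop_for /continuous_at; elim: r => [|j r IH].
    by under eq_fun do rewrite big_nil; rewrite big_nil; exact: (@cvg_cst R 0 _ (nbhs x) _).
  under eq_fun do rewrite big_cons; rewrite big_cons; case: ifP => // _.
  exact: cvgD (proj1 (sF j s x Ux)) IH.
elim: r => [|j r IH].
  by under eq_fun do rewrite big_nil; rewrite big_nil; exact: (@is_derive_cst R _ _ _ x).
under eq_fun do rewrite big_cons; rewrite big_cons; case: ifP => // _.
exact: is_deriveD (smooth_on_is_derive s i (sF j) Ux) IH.
Qed.

End IteratedPartials.

(** * Symmetry of mixed derivatives *)

Section MixedDerivatives.
Set Implicit Arguments.
Unset Strict Implicit.
Context {R : realType} {V : normedModType R}.
Implicit Types (f : V -> R) (x u v : V).

(** Two mean values: first along [u] for the increment [H] of [f] in direction [v], then along [v]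
    for ['D_u f]. *)
Lemma second_difference f x u v (a : R) :
  (forall s s' : R, `|s| <= `|a| -> `|s'| <= `|a| ->
    derivable f (s' *: v + (s *: u + x)) u /\
    derivable ('D_u f) (s' *: v + (s *: u + x)) v) ->
  exists s s' : R, [/\ `|s| <= `|a|, `|s'| <= `|a| &
    f (a *: v + (a *: u + x)) - f (a *: u + x) - (f (a *: v + x) - f x) =
    a * (a * 'D_v ('D_u f) (s' *: v + (s *: u + x)))].
Proof.
move=> df; pose H y := f (y + a *: v) - f y.
have dH s : `|s| <= `|a| -> is_derive (s *: u + x) u H
    ('D_u f (a *: v + (s *: u + x)) - 'D_u f (s *: u + x)).
  move=> sa; apply: is_deriveB.
    rewrite [a *: v + _]addrC; apply/is_derive_translate/derivableP.
    by rewrite addrC; have [] := df s a sa (lexx _).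
  apply: derivableP; have [|+ _] := df s 0 sa _; first by rewrite normr0.
  by rewrite scale0r add0r.
have [|s sa HE] := @MVT_line R V H x u a.
  by move=> s sa; have [] := dH s sa.
have [|s' s'a DE] := @MVT_line R V ('D_u f) (s *: u + x) v a.
  by move=> s' s'a; have [] := df s s' sa s'a.
exists s, s'; split => //; rewrite -DE.
have [_ <-] := dH s sa; rewrite -HE /H.
by rewrite [_ + a *: v]addrC [x + _]addrC.
Qed.

(* Mean values of both mixed derivatives at points near [x] equal the same second
   difference quotient. *)
Lemma schwarz U f x u v : open U -> U x ->
  (forall y, U y -> [/\ derivable f y u, derivable f y v,
    derivable ('D_u f) y v & derivable ('D_v f) y u]) ->
  {for x, continuous ('D_v ('D_u f))} -> {for x, continuous ('D_u ('D_v f))} ->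
  'D_v ('D_u f) x = 'D_u ('D_v f) x.
Proof.
move=> oU Ux df cvu cuv; apply/eqP; rewrite -subr_eq0 -normr_le0.
apply/ler_addgt0Pr => e e0; rewrite add0r.
have e20 : 0 < e / 2 by rewrite divr_gt0.
have /nbhs_normP [d /= d0 dU] : \forall y \near x,
    [/\ U y, `|'D_v ('D_u f) x - 'D_v ('D_u f) y| < e / 2
           & `|'D_u ('D_v f) x - 'D_u ('D_v f) y| < e / 2].
  have oUx : \forall y \near x, U y by apply: open_nbhs_nbhs; split.
  move/cvgrPdist_lt : cvu => /(_ _ e20) Bvu.
  move/cvgrPdist_lt : cuv => /(_ _ e20) Buv.
  exact: (filterS3 _ (fun y Uy vuy uvy => And3 Uy vuy uvy) oUx Bvu Buv).
pose a := d / (`|u| + `|v| + 1).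
have uv0 : 0 < `|u| + `|v| + 1 by rewrite ltr_wpDl// addr_ge0.
have a0 : 0 < a by rewrite divr_gt0.
have dle s s' : `|s| <= `|a| -> `|s'| <= `|a| ->
    `|x - (s' *: v + (s *: u + x))| < d.
  move=> sa s'a; rewrite addrA opprD addrCA subrr addr0 normrN.
  apply: (le_lt_trans (ler_normD _ _)); rewrite !normrZ.
  apply: (@le_lt_trans _ _ (a * (`|u| + `|v|))).
    rewrite mulrDr addrC -(gtr0_norm a0).
    by apply: lerD; apply: ler_wpM2r.
  by rewrite -[ltRHS](divfK (lt0r_neq0 uv0)) ltr_pM2l// ltrDl.
have dle' s s' : `|s| <= `|a| -> `|s'| <= `|a| ->
    `|x - (s *: u + (s' *: v + x))| < d.
  by move=> sa s'a; rewrite addrCA dle.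
have [|s1 [s1' [s1a s1'a E1]]] := @second_difference f x u v a.
  move=> s s' sa s'a; have [/df[d1 _ d2 _] _ _] := dU _ (dle s s' sa s'a).
  exact: (conj d1 d2).
have [|s2 [s2' [s2a s2'a E2]]] := @second_difference f x v u a.
  move=> s s' sa s'a; have [/df[_ d1 _ d2] _ _] := dU _ (dle' s' s s'a sa).
  exact: (conj d1 d2).
(* The second difference is symmetric in [u] and [v], and the factor [a * a] cancels. *)
have EE : 'D_v ('D_u f) (s1' *: v + (s1 *: u + x)) =
          'D_u ('D_v f) (s2' *: u + (s2 *: v + x)).
  apply: (mulfI (lt0r_neq0 a0)); apply: (mulfI (lt0r_neq0 a0)).
  apply: etrans (esym E1) (etrans _ E2).
  rewrite [a *: u + (a *: v + x)]addrCA !opprB addrACA [RHS]addrACA.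
  by congr (_ + _); exact: addrC.
have [_ d1 _] := dU _ (dle _ _ s1a s1'a).
have [_ _ d2] := dU _ (dle' _ _ s2'a s2a).
apply: (le_trans (ler_distD ('D_v ('D_u f) (s1' *: v + (s1 *: u + x))) _ _)).
rewrite [leRHS](splitr e); apply: lerD; first exact: ltW d1.
rewrite distrC in d2.
exact: (eq_ind_r (fun z => `|z - 'D_u ('D_v f) x| <= e / 2) (ltW d2) EE).
Qed.

End MixedDerivatives.

(** * Independence of the order of differentiation *)

Section Permutations.
Set Implicit Arguments.
Unset Strict Implicit.
Context {R : realType} {n : nat}.
Variable U : set 'rV[R]_n.
Hypothesis oU : open U.
Implicit Types (f : 'rV[R]_n -> R) (s : seq 'I_n).

Lemma iterated_partial_swap i j s f x : smooth_on U f -> U x ->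
  iterated_partial (i :: j :: s) f x = iterated_partial (j :: i :: s) f x.
Proof.
move=> sf Ux.
apply: (@schwarz _ _ U (iterated_partial s f) x (delta_mx 0 j) (delta_mx 0 i)) => //.
- move=> y Uy.
  have [_ d0] := sf s y Uy.
  have [_ d1] := sf (j :: s) y Uy.
  have [_ d2] := sf (i :: s) y Uy.
  by split; [exact: d0|exact: d0|exact: d1|exact: d2].
- by have [] := sf (i :: j :: s) x Ux.
- by have [] := sf (j :: i :: s) x Ux.
Qed.

Lemma iterated_partial_perm s s' f x : smooth_on U f -> U x -> perm_eq s s' ->
  iterated_partial s f x = iterated_partial s' f x.
Proof.
move=> sf Ux.
(* Adjacent swaps carry [i] past [s1]. The equality is kept on all of [U] because the induction
   differentiates it again. *)
have shift i s1 s2 : forall y, U y ->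
    iterated_partial (i :: s1 ++ s2) f y = iterated_partial (s1 ++ i :: s2) f y.
  elim: s1 => // j s1 IH y Uy.
  rewrite cat_cons iterated_partial_swap//.
  have s12 : smooth_on U (iterated_partial (s1 ++ i :: s2) f).
    exact: smooth_on_iterated_partial.
  by have [_ /(_ [:: j])] := smooth_on_ext oU IH s12; exact.
elim: s s' x Ux => [|i s IH] s' x Ux ss'.
  by move: ss'; rewrite perm_sym => /perm_nilP ->.
have si : i \in s' by rewrite -(perm_mem ss') mem_head.
case/splitPr: si ss' => s1 s2 ss'.
have {}ss' : perm_eq s (s1 ++ s2).
  rewrite -(perm_cons i); apply: perm_trans ss' _.
  exact: (permEl (perm_catCA s1 [:: i] s2)).
rewrite -shift//.
have s12 := smooth_on_iterated_partial (s1 ++ s2) sf.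
have /smooth_on_ext[//|//|_ E] : forall y, U y ->
    iterated_partial s f y = iterated_partial (s1 ++ s2) f y.
  by move=> y Uy; exact: IH.
exact: (E [:: i] x Ux).
Qed.

End Permutations.

(** * Weights and dilations *)

Section Weights.
Set Implicit Arguments.
Unset Strict Implicit.
Context {n : nat} (w : 'I_n -> nat).
Implicit Types (s : seq 'I_n) (a : 'I_n -> nat).

Definition word_weight s := (\sum_(i <- s) w i)%N.

Definition weight a := (\sum_i w i * a i)%N.

Lemma word_weight_cons i s : word_weight (i :: s) = (w i + word_weight s)%N.
Proof. by rewrite /word_weight big_cons. Qed.

Lemma word_weight_cat s s' :
  word_weight (s ++ s') = (word_weight s + word_weight s')%N.
Proof. by rewrite /word_weight big_cat. Qed.

Lemma word_weight_multi a :
  word_weight (flatten [seq nseq (a i) i | i <- enum 'I_n]) = weight a.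
Proof.
rewrite /word_weight /weight big_flatten big_map big_enum.
by apply: eq_bigr => i _; rewrite big_nseq iter_addn_0.
Qed.

(* Every word is a reordering of the normal form used in [partial_pow]. *)
Lemma perm_multi_count s :
  perm_eq s (flatten [seq nseq (count_mem i s) i | i <- enum 'I_n]).
Proof.
rewrite /perm_eq; apply/allP => x _ /=; apply/eqP.
rewrite count_flatten -map_comp sumnE big_map big_enum /= (bigD1 x)//= big1.
  by rewrite count_nseq /= eqxx mul1n addn0.
by move=> i ix; rewrite count_nseq /= (negPf ix).
Qed.

Lemma word_weight_count s : word_weight s = weight (fun i => count_mem i s).
Proof.
by rewrite -word_weight_multi; apply: perm_big; exact: perm_multi_count.
Qed.

(** Ensures that the exponents of a monomial of weight [k] fit into the finite type ['I_k.+1]. *)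
Lemma count_le_word_weight s i : (forall i, 0 < w i)%N ->
  (count_mem i s <= word_weight s)%N.
Proof.
move=> w0; rewrite word_weight_count /weight (bigD1 i)//=.
by apply: leq_trans (leq_addr _ _); rewrite leq_pmull.
Qed.

End Weights.

(** * Derivatives of functions composed with dilations *)

Section DilationCalculus.
Set Implicit Arguments.
Unset Strict Implicit.
Context {R : realType} {n : nat} (w : 'I_n -> nat).
Implicit Types (U : set 'rV[R]_n) (f : 'rV[R]_n -> R) (s : seq 'I_n) (t : R).

Lemma continuous_dilation t : continuous (dilation w t).
Proof.
(* A neighborhood of a matrix contains a finite product of neighborhoods [P i j] of its entries, so
   continuity is checked entrywise. *)
move=> x A [P Px PA].
have Pij i j : \forall y \near x, P i j (dilation w t y i j).
  have : {for x, continuous (fun y : 'rV[R]_n => t ^+ w j * y 0 j)}.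
    exact: (cvgM (@cvg_cst _ (t ^+ w j) _ (nbhs x) _) (@coord_continuous _ _ _ 0 j x)).
  have := Px i j; rewrite mxE => Pij /(_ _ Pij) H.
  have {}H : \forall y \near x, P i j (t ^+ w j * (y : 'rV[R]_n) 0 j) by [].
  by apply: filterS H => y; rewrite mxE.
have Pall := filter_forall (nbhs_filter x)
  (fun i => filter_forall (nbhs_filter x) (Pij i)).
suff : \forall y \near x, A (dilation w t y) by [].
by apply: filterS Pall => y Py; exact: PA.
Qed.

Lemma open_dilation t U : open U -> open (dilation w t @^-1` U).
Proof. by move=> oU; apply: open_comp => // x _; exact: continuous_dilation. Qed.

Lemma dilation_line t (h : R) i x :
  dilation w t (h *: delta_mx 0 i + x) = (t ^+ w i * h) *: delta_mx 0 i + dilation w t x.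
Proof.
apply/rowP => j; rewrite !mxE eqxx /=.
by case: eqVneq => [->|_]; rewrite ?(mulr1, mulr0, add0r)// mulrDr.
Qed.

(** A dilation maps each coordinate line to a parallel one, scaling its parameter by [t ^+ w i];
    hence the one-variable chain rule suffices. *)
Lemma is_derive_dilation t f i x (df : R) :
  is_derive (dilation w t x) (delta_mx 0 i) f df ->
  is_derive x (delta_mx 0 i) (f \o dilation w t) (t ^+ w i * df).
Proof.
move=> dfx; apply: line_is_derive.
under eq_fun do rewrite /= dilation_line.
rewrite mulrC.
apply: (@is_derive1_comp _ (fun k : R => f (k *: delta_mx 0 i + dilation w t x))
  (fun h => t ^+ w i * h)).
  by apply: is_derive_line; rewrite mulr0 scale0r add0r.
apply: is_derive_eq (is_deriveZ _ (is_derive_id _ _)) _.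
by rewrite [LHS]mulr1.
Qed.

Lemma smooth_on_dilation U f t : open U -> smooth_on U f ->
  smooth_on (dilation w t @^-1` U) (f \o dilation w t) /\
  forall s x, U (dilation w t x) -> iterated_partial s (f \o dilation w t) x =
    t ^+ word_weight w s * iterated_partial s f (dilation w t x).
Proof.
move=> oU sf; apply: (smooth_on_family (G := fun s x =>
  t ^+ word_weight w s * iterated_partial s f (dilation w t x))).
- exact: open_dilation.
- by move=> x _; rewrite /word_weight big_nil mul1r.
- move=> s x Ux.
  have cx := continuous_comp (@continuous_dilation t x) (proj1 (sf s _ Ux)).
  exact: cvgM (@cvg_cst _ (t ^+ word_weight w s) _ (nbhs x) _) cx.
- move=> s i x Ux; rewrite word_weight_cons addnC exprD -mulrA.
  apply: is_deriveZ; apply: is_derive_dilation.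
  exact: smooth_on_is_derive sf Ux.
Qed.

Lemma dilationK t : t != 0 -> cancel (dilation w t) (dilation w t^-1).
Proof.
move=> t0 x; apply/rowP => i.
by rewrite !mxE mulrA -exprMn mulVf// expr1n mul1r.
Qed.

End DilationCalculus.

(** * Functions vanishing to a weighted order *)

Section WeightedVanishing.
Set Implicit Arguments.
Unset Strict Implicit.
Context {R : realType} {n : nat} (w : 'I_n -> nat).
Hypothesis w_gt0 : forall i, (0 < w i)%N.
Implicit Types (U : set 'rV[R]_n) (f : 'rV[R]_n -> R) (s : seq 'I_n).

Lemma coordinate_increment f (y : 'rV[R]_n) (B : 'I_n -> R) :
  (forall z : 'rV[R]_n, (forall j, `|z 0 j| <= `|y 0 j|) -> forall i,
    derivable f z (delta_mx 0 i) /\ `|'D_(delta_mx 0 i) f z| <= B i) ->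
  `|f y - f 0| <= \sum_i `|y 0 i| * B i.
Proof.
(* The path from [0] to [y] through its truncations: consecutive ones differ along one axis, and all
   segments stay in the box spanned by [y]. *)
move=> df; pose trunc k : 'rV[R]_n := \row_j (if (j < k)%N then y 0 j else 0).
have trunc0 : trunc 0 = 0 by apply/rowP => j; rewrite !mxE.
have truncn : trunc n = y by apply/rowP => j; rewrite !mxE ltn_ord.
have truncS (k : 'I_n) : trunc k.+1 = y 0 k *: delta_mx 0 k + trunc k.
  apply/rowP => j; rewrite !mxE eqxx /= ltnS leq_eqVlt -(inj_eq val_inj).
  case: (altP (_ =P _)) => [/val_inj ->|jk] /=; last by rewrite mulr0 add0r.
  by rewrite ltnn mulr1 addr0.
have -> : f y - f 0 = \sum_(i < n) (f (trunc i.+1) - f (trunc i)).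
  rewrite -(big_mkord xpredT (fun i => f (trunc i.+1) - f (trunc i))).
  by rewrite telescope_sumr// truncn trunc0.
apply: le_trans (ler_norm_sum _ _ _) _; apply: ler_sum => i _.
have dfi (s : R) : `|s| <= `|y 0 i| ->
    derivable f (s *: delta_mx 0 i + trunc i) (delta_mx 0 i) /\
    `|'D_(delta_mx 0 i) f (s *: delta_mx 0 i + trunc i)| <= B i.
  move=> sy; apply: df => j; rewrite !mxE eqxx /=.
  case: eqVneq => [->|_]; first by rewrite ltnn mulr1 addr0.
  by rewrite mulr0 add0r; case: ifP => // _; rewrite normr0.
have [s sy|s sy E] := @MVT_line R _ f (trunc i) (delta_mx 0 i) (y 0 i).
  exact: (proj1 (dfi s sy)).
rewrite truncS E normrM; apply: ler_wpM2l => //.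
exact: (proj2 (dfi s sy)).
Qed.

(** Since [w j >= 1], one has [|t| ^+ w j <= |t|] for [|t| <= 1], so the boxes shrink to the origin.
    The proof divides by [rho + 1] because [rho] may vanish. *)
Lemma box_near (A : set 'rV[R]_n) (rho : R) : 0 <= rho -> nbhs (0 : 'rV[R]_n) A ->
  \forall t \near (0 : R), forall y : 'rV[R]_n,
    (forall j, `|y 0 j| <= rho * `|t| ^+ w j) -> A y.
Proof.
move=> rho0 /nbhs_ballP[d /= d0 dA].
have rho1 : 0 < rho + 1 by rewrite ltr_wpDl.
have dr : 0 < d / (rho + 1) by rewrite divr_gt0.
have near_le1 : \forall t \near (0 : R), `|t| <= 1 := nbhs0_le ltr01.
have near_lt : \forall t \near (0 : R), `|t| < d / (rho + 1) := nbhs0_lt dr.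
apply: (filterS2 _ _ near_le1 near_lt) => t t1 td y yt; apply: dA.
split => // i j; rewrite ord1 mxE /ball /= sub0r normrN.
apply: le_lt_trans (yt j) _; rewrite ltr_pdivlMr// in td.
apply: le_lt_trans td; rewrite mulrC.
apply: ler_pM => //.
  by rewrite -[leRHS]expr1; apply: ler_wiXn2l.
by rewrite lerDl.
Qed.

Lemma weighted_vanishing_bound (M : nat) U f (rho : R) : open U -> U 0 ->
  smooth_on U f ->
  (forall s, (word_weight w s < M)%N -> iterated_partial s f 0 = 0) ->
  0 <= rho -> exists C : R, \forall t \near (0 : R), forall y : 'rV[R]_n,
    (forall j, `|y 0 j| <= rho * `|t| ^+ w j) -> `|f y| <= C * `|t| ^+ M.
Proof.
move=> oU U0 + + rho0; elim/ltn_ind: M f => -[_|M IH] f sf f0.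
  (* Order zero asks only for boundedness near the origin, which continuity gives. *)
  exists (`|f 0| + 1).
  have A : \forall y \near (0 : 'rV[R]_n), `|f y| <= `|f 0| + 1.
    have [/cvgrPdist_lt /(_ _ ltr01) cf _] := sf [::] 0 U0.
    apply: filterS cf => y fy.
    rewrite -lerBlDl (le_trans (lerB_dist _ _))// distrC ltW//.
  apply: filterS (box_near rho0 A) => t At y yt.
  by rewrite expr0 mulr1; exact: At.
(* The subtraction is truncated: for [w i > M.+1] the partial derivative is merely bounded, and the
   factor [|t| ^+ w i] does the rest. *)
have /choice[C HC] i : exists C : R, \forall t \near (0 : R), forall y : 'rV[R]_n,
    (forall j, `|y 0 j| <= rho * `|t| ^+ w j) ->
    `|iterated_partial [:: i] f y| <= C * `|t| ^+ (M.+1 - w i).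
  apply: IH.
  - by rewrite ltn_subrL w_gt0.
  - exact: smooth_on_iterated_partial.
  - move=> s sM; rewrite -iterated_partial_cat; apply: f0.
    by rewrite word_weight_cat [X in (_ + X)%N]big_seq1 addnC -ltn_subRL.
exists (\sum_i rho * `|C i|).
have HU := box_near rho0 (open_near oU U0).
have t1 : \forall t \near (0 : R), `|t| <= 1 := nbhs0_le ltr01.
apply: (filterS3 _ _ (filter_forall _ HC) HU t1) => t HCt HUt t1t y yt.
have f00 : f 0 = 0 by apply: (f0 [::]); rewrite /word_weight big_nil.
have -> : f y = f y - f 0 by rewrite f00 subr0.
apply: le_trans (coordinate_increment
  (B := fun i => `|C i| * `|t| ^+ (M.+1 - w i)) _) _.
  move=> z zy i.
  have zt j : `|z 0 j| <= rho * `|t| ^+ w j := le_trans (zy j) (yt j).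
  have [_ dz] := sf [::] z (HUt z zt); split; first exact: dz.
  apply: le_trans (HCt i z zt) _.
  by rewrite ler_wpM2r// ?exprn_ge0// ler_norm.
rewrite mulr_suml; apply: ler_sum => i _.
apply: (@le_trans _ _ (rho * `|t| ^+ w i * (`|C i| * `|t| ^+ (M.+1 - w i)))).
  by rewrite ler_wpM2r// mulr_ge0// exprn_ge0.
(* By truncation the exponent [w i + (M.+1 - w i)] is only at least [M.+1]; [|t| <= 1] closes the
   gap. *)
rewrite mulrACA -exprD ler_wpM2l ?mulr_ge0//.
by rewrite ler_wiXn2l// -leq_subLR.
Qed.

End WeightedVanishing.

(** * Weighted Taylor parts *)

Section WeightedTaylor.
Set Implicit Arguments.
Unset Strict Implicit.
Context {R : realType} {n : nat} (w : 'I_n -> nat).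
Implicit Types (U : set 'rV[R]_n) (f : 'rV[R]_n -> R) (s : seq 'I_n).

(* The [c]-th derivative of [y ^ k / k!]. Divided powers make differentiation a
   mere shift of exponents, hence the product formula of [smooth_divmonomial]. *)
Definition divpow_deriv (k c : nat) (y : R) : R :=
  if (c <= k)%N then y ^+ (k - c) / (k - c)`!%:R else 0.

Definition divmonomial (b : 'I_n -> nat) (x : 'rV[R]_n) : R :=
  \prod_i (x 0 i ^+ b i / (b i)`!%:R).

Lemma is_derive_divpow k c (y : R) :
  is_derive y 1 (divpow_deriv k c) (divpow_deriv k c.+1 y).
Proof.
(* For [c = k] the function is the constant [1], for [c > k] it is zero; only [c < k] needs the
   power rule. *)
rewrite /divpow_deriv; case: (ltngtP c k) => [ck|kc|->]; last first.
- rewrite subnn; under eq_fun do rewrite expr0; exact: is_derive_cst.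
- exact: is_derive_cst.
rewrite -(subnSK ck); set m := (k - c.+1)%N.
have -> : (fun y : R => y ^+ m.+1 / m.+1`!%:R) = m.+1`!%:R^-1 *: (@GRing.exp R ^~ m.+1).
  by apply/funext => z; rewrite /= mulrC.
have dX : is_derive y 1 (@GRing.exp R ^~ m.+1) (m.+1%:R * y ^+ m).
  split; first exact: exprn_derivable.
  by rewrite exp_derive /= /GRing.scale /= mulr1.
apply: is_derive_eq (is_deriveZ _ dX) _.
by rewrite factS natrM invfM /GRing.scale /= mulrACA mulVf ?pnatr_eq0// mul1r mulrC.
Qed.

Lemma continuous_divpow k c : continuous (divpow_deriv k c).
Proof.
move=> y; apply/differentiable_continuous/derivable1_diffP.
by have [] := is_derive_divpow k c y.
Qed.

Lemma smooth_divmonomial U (b : 'I_n -> nat) : open U ->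
  smooth_on U (divmonomial b) /\
  forall s x, U x -> iterated_partial s (divmonomial b) x =
    \prod_i divpow_deriv (b i) (count_mem i s) (x 0 i).
Proof.
move=> oU; apply: (smooth_on_family (G := fun s x =>
    \prod_i divpow_deriv (b i) (count_mem i s) (x 0 i))) => //.
- by move=> x _; apply: eq_bigr => i _; rewrite /divpow_deriv leq0n subn0.
- move=> s x _; rewrite /prop_for /continuous_at.
  apply: (@cvg_big R 'I_n *%R 1 xpredT (@mul_continuous R) _ (nbhs x)) => i _.
  exact: continuous_comp (@coord_continuous _ _ _ 0 i x) (@continuous_divpow _ _ _).
- move=> s i x _; apply: line_is_derive.
  (* These factors are constant along the [i]-th coordinate line. *)
  pose K := \prod_(j | j != i) divpow_deriv (b j) (count_mem j s) (x 0 j).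
  have -> : (fun h : R => \prod_j divpow_deriv (b j) (count_mem j s)
      ((h *: delta_mx 0 i + x) 0 j)) =
      K *: (fun h => divpow_deriv (b i) (count_mem i s) (h + x 0 i)).
    apply/funext => h; rewrite (bigD1 i)//= mulrC !mxE !eqxx mulr1.
    congr (_ * _); apply: eq_bigr => j ji.
    by rewrite !mxE eqxx (negPf ji) mulr0 add0r.
  have D : is_derive (0 : R) 1 (fun h => divpow_deriv (b i) (count_mem i s) (h + x 0 i))
      (divpow_deriv (b i) (count_mem i s).+1 (x 0 i)).
    apply: is_derive_translate; rewrite add0r; exact: is_derive_divpow.
  apply: is_derive_eq (is_deriveZ K D) _.
  rewrite [RHS](bigD1 i)//= eqxx add1n mulrC; congr (_ * _).
  by apply: eq_bigr => j ji; rewrite eq_sym (negPf ji).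
Qed.

Lemma divmonomial_dilation (b : 'I_n -> nat) t x :
  divmonomial b (dilation w t x) = t ^+ weight w b * divmonomial b x.
Proof.
rewrite /weight expr_sum -big_split; apply: eq_bigr => i _ /=.
by rewrite mxE exprMn exprM mulrA.
Qed.

Lemma divpow_deriv0 k c : divpow_deriv k c 0 = (c == k)%:R.
Proof.
rewrite /divpow_deriv; case: ltngtP => [ck| |->] //; last first.
  by rewrite subnn expr0 fact0 divr1.
by rewrite expr0n subn_eq0 leqNgt ck mul0r.
Qed.

(** Divided monomials are dual to the derivatives at the origin, so Taylor coefficients need no
    factorials. *)
Lemma iterated_partial_divmonomial0 s (b : 'I_n -> nat) :
  iterated_partial s (divmonomial b) 0 = [forall i, count_mem i s == b i]%:R.
Proof.
rewrite (proj2 (smooth_divmonomial b openT) s 0 I).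
under eq_bigr do rewrite mxE divpow_deriv0.
case: forallP => [cb|/forallP/forallPn[i /negPf cbi]].
  by rewrite big1 // => i _; rewrite cb.
by rewrite (bigD1 i)//= cbi mul0r.
Qed.

Definition exponents k (b : {ffun 'I_n -> 'I_k.+1}) (i : 'I_n) : nat := b i.

(** The part of weighted degree [k] of the Taylor series at the origin. For positive weights,
    bounding the exponents by [k] loses no monomial. *)
Definition taylor_part k f (x : 'rV[R]_n) : R :=
  \sum_(b : {ffun 'I_n -> 'I_k.+1} | weight w (exponents b) == k)
    partial_pow (exponents b) f 0 * divmonomial (exponents b) x.

Lemma smooth_taylor_part U k f : open U ->
  smooth_on U (taylor_part k f) /\
  forall s x, U x -> iterated_partial s (taylor_part k f) x =
    \sum_(b : {ffun 'I_n -> 'I_k.+1} | weight w (exponents b) == k)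
      partial_pow (exponents b) f 0 * iterated_partial s (divmonomial (exponents b)) x.
Proof.
move=> oU.
have sZ (b : {ffun 'I_n -> 'I_k.+1}) := smooth_onZ (partial_pow (exponents b) f 0) oU
  (proj1 (smooth_divmonomial (exponents b) oU)).
have [sS SE] := smooth_on_sum (index_enum _) (fun b => weight w (exponents b) == k) oU
  (fun b => proj1 (sZ b)).
split=> // s x Ux; rewrite /taylor_part SE//.
by apply: eq_bigr => b _; rewrite (proj2 (sZ b)).
Qed.

Lemma taylor_part_dilation k f t x :
  taylor_part k f (dilation w t x) = t ^+ k * taylor_part k f x.
Proof.
rewrite mulr_sumr; apply: eq_bigr => b /eqP wb.
by rewrite divmonomial_dilation wb mulrCA.
Qed.

(** Only the monomial whose exponents are the letter counts of [s] survives; symmetry of mixed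
    derivatives identifies its coefficient with the derivative along [s]. *)
Lemma iterated_partial_taylor_part0 U k f s : (forall i, 0 < w i)%N ->
  open U -> U 0 -> smooth_on U f ->
  iterated_partial s (taylor_part k f) 0 =
    if word_weight w s == k then iterated_partial s f 0 else 0.
Proof.
move=> w0 oU U0 sf; rewrite (proj2 (smooth_taylor_part k f oU))//.
under eq_bigr do rewrite iterated_partial_divmonomial0.
have [sk|sk] := eqVneq; last first.
  apply: big1 => b /eqP wb; case: forallP => [cb|_]; last by rewrite mulr0.
  case/eqP: sk; rewrite word_weight_count -wb; apply: eq_bigr => i _.
  by rewrite (eqP (cb i)).
(* No count exceeds the weight [k], so [inord] does not fall back to its default. *)
pose b0 : {ffun 'I_n -> 'I_k.+1} := [ffun i => inord (count_mem i s)].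
have b0E i : b0 i = count_mem i s :> nat.
  by rewrite ffunE inordK// ltnS -sk count_le_word_weight.
have wb0 : weight w (exponents b0) == k.
  apply/eqP; rewrite -[RHS]sk word_weight_count.
  by apply: eq_bigr => i _; rewrite -b0E.
rewrite (bigD1 b0)//= [X in _ + X]big1 ?addr0.
  have -> : [forall i, count_mem i s == exponents b0 i].
    by apply/forallP => i; rewrite -b0E.
  rewrite mulr1 /partial_pow.
  have -> : [seq nseq (exponents b0 i) i | i <- enum 'I_n] =
      [seq nseq (count_mem i s) i | i <- enum 'I_n].
    by apply: eq_map => i; rewrite -b0E.
  by apply/esym/(iterated_partial_perm oU sf U0)/perm_multi_count.
move=> b /andP[_ bb0]; case: forallP => [cb|_]; last by rewrite mulr0.
case/eqP: bb0; apply/ffunP => i; apply/val_inj.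
by rewrite /= b0E (eqP (cb i)).
Qed.

(** Degrees are integers because [l + <w,a>] can be negative; no monomial has such a degree. *)
Definition homogeneous_part (l : int) f : 'rV[R]_n -> R :=
  if l is Posz k then taylor_part k f else fun=> 0.

Lemma smooth_homogeneous_part U l f : open U -> smooth_on U (homogeneous_part l f).
Proof.
move=> oU; case: l => k /=; last exact: (proj1 (smooth_on_cst 0 oU)).
exact: (proj1 (smooth_taylor_part k f oU)).
Qed.

Lemma homogeneous_part_dilation l f t x :
  homogeneous_part l f (dilation w t x) = t ^ l * homogeneous_part l f x.
Proof. by case: l => k /=; [exact: taylor_part_dilation|rewrite mulr0]. Qed.

Lemma iterated_partial_homogeneous_part0 U l f s : (forall i, 0 < w i)%N ->
  open U -> U 0 -> smooth_on U f ->
  iterated_partial s (homogeneous_part l f) 0 =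
    if (word_weight w s)%:Z == l then iterated_partial s f 0 else 0.
Proof.
move=> w0 oU U0 sf; case: l => k /=.
  by rewrite (iterated_partial_taylor_part0 _ _ w0 oU U0 sf).
by rewrite (proj2 (smooth_on_cst 0 oU))//; case: s.
Qed.

End WeightedTaylor.

(** * The expansion *)

Section ExpansionOfPullbacks.
Set Implicit Arguments.
Unset Strict Implicit.
Context {R : realType} {n : nat} (w : 'I_n -> nat).
Hypothesis w_gt0 : forall i, (0 < w i)%N.
Implicit Types (U : set 'rV[R]_n) (f u : 'rV[R]_n -> R) (s : seq 'I_n).

(** The origin of the lower end [-mr] of the expansion: a pullback brings in the powers
    [t^(-<w,a>)]. *)
Lemma weight_mindex_le r m (a : mindex n m) : (forall i, w i <= r)%N ->
  (weight w (mindex_fun a) <= m * r)%N.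
Proof.
move=> wr; apply: (@leq_trans (\sum_i r * mindex_fun a i)).
  by apply: leq_sum => i _; rewrite leq_mul2r wr orbT.
by rewrite -big_distrr /= [leqRHS]mulnC leq_mul2l (valP a) orbT.
Qed.

Lemma partial_pow_dilation U u (a : 'I_n -> nat) t x : open U -> smooth_on U u ->
  U (dilation w t x) ->
  partial_pow a (u \o dilation w t) x =
    t ^+ weight w a * partial_pow a u (dilation w t x).
Proof.
move=> oU su Ux; rewrite /partial_pow (proj2 (smooth_on_dilation w t oU su))//.
by rewrite word_weight_multi.
Qed.

(** Differentiating [u] composed with the inverse dilation yields the factor [t^(-<w,a>)]. The set
    [V] is kept general to serve both the preimage of [U] and the whole space. *)
Lemma pullbackE m U (P : diffop m U) V u t x : t != 0 -> open V ->
  smooth_on V u -> V x ->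
  pullback w t P u x = \sum_a t ^- weight w (mindex_fun a) *
    coef P a (dilation w t x) * partial_pow (mindex_fun a) u x.
Proof.
move=> t0 oV su Vx; apply: eq_bigr => a _.
have xK := dilationK w t0 x.
rewrite (partial_pow_dilation _ oV su) ?xK//.
by rewrite exprVn mulrA [_^-1 * _]mulrC.
Qed.

Lemma coord_le_norm (x : 'rV[R]_n) j : `|x 0 j| <= `|x|.
Proof.
rewrite [leRHS]/Num.norm/= mx_normE -[leLHS]nngE num_le.
exact: (le_bigmax _ (fun i : 'I_1 * 'I_n => `|x i.1 i.2|%:nng) (0, j)).
Qed.

Lemma mem_zrange (a b l : int) : (l \in zrange a b) = (a <= l < b).
Proof.
apply/mapP/idP => [[k]|/andP[al lb]].
  rewrite mem_iota add0n => /andP[_ kab] ->.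
  rewrite lerDl /= -ltrBrDl.
  by move: kab; case: (leP 0 (b - a)) => h; case: (b - a) h => //.
exists (absz (l - a)); last by rewrite gez0_abs ?subr_ge0// addrCA subrr addr0.
rewrite mem_iota add0n leq0n /= -ltz_nat !gez0_abs ?subr_ge0// ?le_max ?lexx//.
by rewrite lt_max ltrD2r lb orbT.
Qed.

Lemma zrange_uniq (a b : int) : uniq (zrange a b).
Proof. by rewrite map_inj_uniq ?iota_uniq// => i j /addrI[]. Qed.

(** * Taylor remainder of a single coefficient *)

Section Remainder.
Variables (U : set 'rV[R]_n) (f : 'rV[R]_n -> R) (A : nat) (l0 N : int).
Hypotheses (oU : open U) (U0 : U 0) (sf : smooth_on U f) (l0A : l0 <= - A%:Z).

(** Here [A] stands for the weight [<w,a>] of the multi-index of the coefficient [f]. As [l0 <= -A],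
    all weighted degrees below [N + A] are removed. *)
Let g y := f y - \sum_(l <- zrange l0 N) homogeneous_part w (l + A%:Z) f y.

Lemma smooth_remainder : smooth_on U g /\
  forall s x, U x -> iterated_partial s g x = iterated_partial s f x -
    \sum_(l <- zrange l0 N) iterated_partial s (homogeneous_part w (l + A%:Z) f) x.
Proof.
have [sS SE] := smooth_on_sum (zrange l0 N) xpredT oU
  (fun l => smooth_homogeneous_part w (l + A%:Z) f oU).
have [sg gE] := smooth_onB oU sf sS.
by split=> // s x Ux; rewrite gE// SE.
Qed.

(** Only the term [l = word_weight w s - A] can contribute at the origin, and it cancels the
    derivative of [f]. *)
Lemma remainder_vanishing s : (word_weight w s)%:Z < N + A%:Z ->
  iterated_partial s g 0 = 0.
Proof.
move=> sN; rewrite (proj2 smooth_remainder)//.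
have sl : (word_weight w s)%:Z - A%:Z \in zrange l0 N.
  by rewrite mem_zrange ltrBlDr sN (le_trans l0A)// lerDr.
rewrite (bigD1_seq _ sl (zrange_uniq _ _))/=.
rewrite (iterated_partial_homogeneous_part0 _ _ w_gt0 oU U0 sf).
rewrite subrK eqxx big1 ?addr0 ?subrr// => l /negP lA.
rewrite (iterated_partial_homogeneous_part0 _ _ w_gt0 oU U0 sf).
by case: eqVneq => // E; case: lA; rewrite E addrK.
Qed.

Lemma rescaled_remainder t y : t != 0 ->
  t ^- A * f (dilation w t y) -
    \sum_(l <- zrange l0 N) t ^ l * homogeneous_part w (l + A%:Z) f y =
  t ^- A * g (dilation w t y).
Proof.
move=> t0; rewrite mulrBr mulr_sumr; congr (_ - _); apply: eq_bigr => l _.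
rewrite homogeneous_part_dilation expfzDr// mulrA [_ * t ^ A]mulrC mulrA.
by rewrite mulVf ?mul1r// expf_neq0.
Qed.

(** The derivative along [s] gains the factor [t ^+ word_weight w s], exactly making up for the
    vanishing order that [g] loses. *)
Lemma rescaled_remainder_bound (K : set 'rV[R]_n) s : compact K ->
  exists C : R, \forall t \near (0 : R)^', forall x, K x ->
    `|iterated_partial s (fun y => t ^- A * f (dilation w t y) -
        \sum_(l <- zrange l0 N) t ^ l * homogeneous_part w (l + A%:Z) f y) x|
    <= C * `|t ^ N|.
Proof.
move=> cK; have [B [_ KB]] := compact_bounded cK.
(* A radius bounding [K], so that dilated points of [K] lie in the boxes
   [|y_j| <= rho * |t| ^+ w j]. *)
pose rho := `|B| + 1.
have rho0 : 0 <= rho by rewrite addr_ge0.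
have Krho x : K x -> `|x| <= rho.
  by apply: KB; rewrite (le_lt_trans (ler_norm _))// ltrDl.
have [sg gE] := smooth_remainder.
(* The remaining vanishing order, clipped at [0]. When clipping occurs, the powers of [t] in front
   already give the bound. *)
pose M := absz (Num.max 0 (N + A%:Z - (word_weight w s)%:Z)).
have ME : M%:Z = Num.max 0 (N + A%:Z - (word_weight w s)%:Z).
  by rewrite gez0_abs// le_max lexx.
have [|C HC] := weighted_vanishing_bound w_gt0 (M := M) oU U0
    (smooth_on_iterated_partial s sg) _ rho0.
  move=> s' s'M; rewrite -iterated_partial_cat; apply: remainder_vanishing.
  move: s'M; rewrite -ltz_nat ME lt_max ltNge lez_nat leq0n /= => s'M.
  by rewrite word_weight_cat PoszD -ltrBrDr.
exists `|C|.
have HU := box_near w_gt0 rho0 (open_near oU U0).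
have near_le1 : \forall t \near (0 : R), `|t| <= 1 := nbhs0_le ltr01.
near=> t => x Kx.
have t0 : t != 0 by near: t; exact: nbhs_dnbhs_neq.
have t1 : `|t| <= 1 by near: t; exact: nbhs_dnbhs near_le1.
have tU : forall y : 'rV[R]_n, (forall j, `|y 0 j| <= rho * `|t| ^+ w j) -> U y.
  by near: t; exact: nbhs_dnbhs HU.
have tC : forall y : 'rV[R]_n, (forall j, `|y 0 j| <= rho * `|t| ^+ w j) ->
    `|iterated_partial s g y| <= C * `|t| ^+ M.
  by near: t; exact: nbhs_dnbhs HC.
have xbox j : `|dilation w t x 0 j| <= rho * `|t| ^+ w j.
  rewrite mxE normrM normrX mulrC ler_wpM2r ?exprn_ge0//.
  exact: le_trans (coord_le_norm x j) (Krho x Kx).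
under eq_fun do rewrite rescaled_remainder//.
have [sgt gtE] := smooth_on_dilation w t oU sg.
have oV := open_dilation (w := w) (t := t) oU.
rewrite (proj2 (smooth_onZ (t ^- A) oV sgt)); last exact: tU.
rewrite gtE; last exact: tU.
have normtN : `|t ^ N| = `|t| ^ N.
  by case: (N) => k; rewrite ?NegzE ?exprnN ?normfV normrX.
rewrite !normrM normfV !normrX normtN.
apply: (@le_trans _ _ (`|t| ^- A * (`|t| ^+ word_weight w s * (`|C| * `|t| ^+ M)))).
  rewrite ler_wpM2l ?invr_ge0 ?exprn_ge0// ler_wpM2l ?exprn_ge0//.
  by rewrite (le_trans (tC _ xbox))// ler_wpM2r ?exprn_ge0// ler_norm.
rewrite [_ * (`|C| * _)]mulrCA [X in X <= _]mulrCA ler_wpM2l// -exprD.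
(* The excess [p] is the amount clipped in [M]; the factor [|t|^p] is at most [1]. *)
have [p pE] : exists p : nat, (word_weight w s + M)%:Z = A%:Z + N + p%:Z.
  exists (absz ((word_weight w s + M)%:Z - (A%:Z + N))%R).
  rewrite gez0_abs ?subrKC//.
  rewrite subr_ge0 PoszD ME -lerBlDl addrC [_ + N]addrC le_max.
  by rewrite [- _ + _]addrC lexx orbT.
have nt0 : `|t| != 0 by rewrite normr_eq0.
rewrite -[`|t| ^+ (_ + _)]/(`|t| ^ (word_weight w s + M)%:Z) pE !expfzDr//.
rewrite -mulrA mulKf ?expf_neq0// ler_piMr ?exprz_ge0//.
exact: exprn_ile1.
Unshelve. all: by end_near. Qed.

End Remainder.

End ExpansionOfPullbacks.

Theorem proposition4p29 (R : realType) (n r : nat) (w : 'I_n -> nat)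
  (w_range : forall i : 'I_n, (1 <= w i <= r)%N)
  (w_mono : forall i j : 'I_n, (i <= j)%N -> (w i <= w j)%N)
  (U : set 'rV[R]_n) (U_open : open U) (U0 : U 0)
  (m : nat) (P : diffop m U) :
  exists (D : forall t : R, diffop m (dilation w t @^-1` U))
         (Q : int -> diffop m [set: 'rV[R]_n]),
    [/\ forall t : R, t != 0 -> is_pullback P (D t),
        forall l : int, - (m * r)%:Z <= l -> homogeneous w l (Q l)
      & asymptotic_expansion D (- (m * r)%:Z) Q].
Proof.
have w_gt0 i : (0 < w i)%N by have /andP[] := w_range i.
have w_le i : (w i <= r)%N by have /andP[] := w_range i.
(* Defined for [t = 0] too, as the type of [D] demands; that value is never examined. *)
have sD t a := proj1 (smooth_onZ (t ^- weight w (mindex_fun a))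
  (open_dilation (w := w) (t := t) U_open)
  (proj1 (smooth_on_dilation w t U_open (coef_smooth P a)))).
have sQ l a := smooth_homogeneous_part w (l + (weight w (mindex_fun a))%:Z)
  (coef P a) openT.
exists (fun t => DiffOp (sD t)), (fun l => DiffOp (sQ l)); split.
- move=> t t0 u su x Ux.
  by rewrite (@pullbackE _ _ w _ _ _ _ _ _ _ t0 (open_dilation U_open) su Ux).
- move=> l _ t t0 u su x.
  (* The factor [t^(-<w,a>)] of the pullback meets [t^(l + <w,a>)] from the coefficient, leaving
     [t^l]. *)
  rewrite (@pullbackE _ _ w _ _ _ _ _ _ _ t0 openT su)// mulr_sumr; apply: eq_bigr => a _ /=.
  rewrite homogeneous_part_dilation expfzDr// -exprnP -!mulrA.
  by rewrite [t ^- _ * _]mulrCA mulKf// expf_neq0.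
- move=> N K cK KU a s.
  have l0A : - (m * r)%:Z <= - (weight w (mindex_fun a))%:Z.
    by rewrite lerN2 lez_nat weight_mindex_le.
  exact: (rescaled_remainder_bound w_gt0 N U_open U0 (coef_smooth P a) l0A s cK).
Qed.
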